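(* Let $m,n$ be positive integers with $m\geq 3$ odd, and let $w=e^{2\pi i/m}$. Then $$\zeta(\{2m\}^n)=\frac{2\cdot(2\pi)^{2mn}}{(2mn+m)!}\left\{\sum_{r=1}^{(m-1)/2}(-1)^{r-1}\sum_{0\leq j_1<j_2<\cdots<j_r\leq m-1}\left(w^{j_1}+w^{j_2}+\cdots+w^{j_r}\right)^{2mn+m}\right\}.$$
   Context: $\zeta(\{2m\}^n)=\sum_{1\leq k_1<\cdots<k_n}(k_1k_2\cdots k_n)^{-2m}$, the multiple zeta value with $n$ arguments all equal to $2m$. *)

(* Defs.v *)
From mathcomp Require Export all_boot all_order all_algebra.
From mathcomp Require Export all_classical all_reals all_analysis.
From mathcomp Require Export complex.

Set Implicit Arguments.
Unset Strict Implicit.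
Unset Printing Implicit Defensive.

Import Order.TTheory GRing.Theory Num.Theory.
Local Open Scope classical_set_scope.
Local Open Scope complex_scope.
Local Open Scope ring_scope.

(* zeta({s}^n). The value is an extended real, +oo when the series diverges,
   so that convergence has to be stated separately. The condition
   path ltn 0 k says 0 < k_1 < ... < k_n. *)
Definition mzv_rep (R : realType) (s n : nat) : \bar R :=
  \esum_(k in [set k : n.-tuple nat | path ltn 0%N k])
     (((\prod_(i < n) (tnth k i)%:R) ^- s : R)%:E).

Definition cexp (R : realType) (z : R[i]) : R[i] :=
  (expR (complex.Re z))%:C * (cos (complex.Im z) +i* sin (complex.Im z)).

(* Main.v *)
(* For odd N = 2M + 1,
     (1 + y)^N - (1 - y)^N = 2 N y prod_{k = 1}^{M} (1 + y^2 / tan^2 (pi k / N)).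
   Take y = w^j z / N and multiply over 0 <= j < m: as the (w^2)^j run through the
   m-th roots of unity, the right-hand side becomes
     2^m z^m prod_k (1 + z^(2m) / (N tan (pi k / N))^(2m)),
   whose coefficient of z^(2mn+m) is 2^m times an elementary symmetric sum which
   tends to zeta({2m}^n) / pi^(2mn) as M grows. On the left-hand side, expanding
   the product over the set A of the indices j where the first term is chosen, the
   same coefficient tends to that of sum_A (-1)^(m - |A|) exp (2 s_A z), where s_A
   is the sum of the w^j for j in A. Finally, A and its complement contribute
   equally. This is a finite form of the product formula for sin (pi x), avoiding
   infinite products of complex functions. *)
Require Import Defs.
From mathcomp Require Import all_boot all_order all_algebra.
From mathcomp Require Import all_classical all_reals all_analysis.
From mathcomp Require Import complex.
From mathcomp Require Import ring lra zify.

Set Implicit Arguments.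
Unset Strict Implicit.
Unset Printing Implicit Defensive.

Import Order.TTheory GRing.Theory Num.Theory.
Import numFieldNormedType.Exports.
Local Open Scope complex_scope.
Local Open Scope ring_scope.

(** * Finite sums and products *)

Lemma sorted_map_val_enum (n : nat) (A : {set 'I_n}) :
  sorted ltn (map val (enum A)).
Proof.
rewrite -[enum _](eq_filter (mem_enum _)) -(eq_filter (mem_map val_inj _)).
rewrite -filter_map (sorted_filter ltn_trans) //.
by rewrite unlock val_ord_enum iota_ltn_sorted.
Qed.

Lemma sorted_map_val_uniq (n : nat) (t : seq 'I_n) :
  sorted ltn (map val t) -> uniq t.
Proof.
by rewrite -(map_inj_uniq val_inj); exact: (sorted_uniq ltn_trans ltnn).
Qed.

(** A strictly increasing tuple is determined by its support, with inverse [enum]. This inverse is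
    partial, through [insub], since [enum A] has length [r] only when [A] has [r] elements. *)
Lemma sum_sorted_tuple (V : nmodType) (n r : nat) (F : {set 'I_n} -> V) :
  \sum_(t : r.-tuple 'I_n | sorted ltn (map val t)) F [set x in t] =
  \sum_(A : {set 'I_n} | #|A| == r) F A.
Proof.
have szE (A : {set 'I_n}) : (size (enum A) == r) = (#|A| == r) by rewrite -cardE.
rewrite [RHS](reindex_omap (fun t : r.-tuple 'I_n => [set x in t])
  (fun A => insub (enum A))) /=; last first.
  move=> A cA; rewrite insubT ?szE //= => sA; congr Some.
  by apply/setP=> x; rewrite inE /= mem_enum.
apply: eq_bigl => t; apply/idP/andP => [st|[/eqP ct]].
  have ct : #|[set x in t]| = r.
    by rewrite cardsE (card_uniqP (sorted_map_val_uniq st)) size_tuple.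
  rewrite ct eqxx; split => //.
  rewrite insubT ?szE ?ct //= => sA; apply/eqP; congr Some; apply: val_inj => /=.
  apply: (inj_map val_inj); apply: (irr_sorted_eq ltn_trans ltnn) => //.
    exact: sorted_map_val_enum.
  by move=> y; apply/mapP/mapP => -[x xt ->]; exists x; rewrite // mem_enum inE in xt *.
rewrite insubT ?szE ?ct //= => sA /eqP[<-] /=.
exact: sorted_map_val_enum.
Qed.

Lemma big_tnth_set (V : Type) (idx : V) (op : Monoid.com_law idx) (n r : nat)
    (t : r.-tuple 'I_n) (f : 'I_n -> V) :
  uniq t -> \big[op/idx]_(i < r) f (tnth t i) = \big[op/idx]_(j in [set x in t]) f j.
Proof.
move=> ut; rewrite -(big_tuple _ _ t xpredT f) big_uniq //=.
by apply: eq_bigl => j; rewrite inE.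
Qed.

Lemma coef_prod_1addZX (F : comNzRingType) (I : finType) (f : I -> F) (n : nat) :
  (\prod_(i : I) (1 + f i *: 'X))`_n =
  \sum_(A : {set I} | #|A| == n) \prod_(i in A) f i.
Proof.
under eq_bigr do rewrite addrC.
rewrite bigA_distr coef_sum [RHS]big_mkcond /=; apply: eq_bigr => A _.
rewrite -big_mkcond /=; under eq_bigr do rewrite -mul_polyC.
rewrite big_split /= prodr_const -rmorph_prod coefCM coefXn eq_sym.
by case: eqP => _; rewrite ?mulr1 ?mulr0.
Qed.

(** Evaluate [X^m - 1 = prod_j (X - v^j)] at 0; the signs agree because [m] is odd. *)
Lemma prod_prim_root (F : fieldType) (m : nat) (v : F) :
  odd m -> m.-primitive_root v -> \prod_(j < m) v ^+ j = 1.
Proof.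
move=> mo vp; have /(congr1 (fun p => p.[0])) := factor_Xn_sub_1 vp.
rewrite big_mkord horner_prod !hornerE.
under eq_bigr do rewrite !hornerE.
rewrite expr0n; have -> : (m == 0)%N = false by case: m mo {vp}.
rewrite prodrN card_ord -signr_odd mo expr1 sub0r mulN1r.
by move/oppr_inj.
Qed.

(** With [u] the inverse of [v], substitute [-c] for [X] in [X^m - 1 = prod_j (X - u^j)], then write
    [1 + v^j c = v^j (c + u^j)]; the factors [v^j] multiply to 1. *)
Lemma prod_1add_prim_root (F : fieldType) (m : nat) (v : F) (c : {poly F}) :
  odd m -> m.-primitive_root v -> \prod_(j < m) (1 + v ^+ j *: c) = 1 + c ^+ m.
Proof.
move=> mo vp; have m0 : (0 < m)%N by case: m mo {vp}.
(* The inverse of [v] is written [v ^+ m.-1], a power coprime to the order, hence again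
   primitive. *)
have up : m.-primitive_root (v ^+ m.-1).
  by rewrite prim_root_exp_coprime // coprimePn.
have vu j : v ^+ j * (v ^+ m.-1) ^+ j = 1.
  by rewrite -exprMn -exprS prednK // (prim_expr_order vp) expr1n.
have /(congr1 (fun p => - (p \Po (- c)))) := factor_Xn_sub_1 up.
rewrite big_mkord rmorph_prod /= rmorphB rmorphXn /= rmorph1 comp_polyX.
rewrite exprNn -signr_odd mo expr1 mulN1r opprB opprK => <-.
rewrite (eq_bigr (fun j : 'I_m => (v ^+ j)%:P * (c + (v ^+ m.-1 ^+ j)%:P))); last first.
  by move=> j _; rewrite mulrDr -polyCM vu addrC mul_polyC.
rewrite big_split /= -rmorph_prod prod_prim_root //= mul1r.
under [in RHS]eq_bigr do rewrite rmorphB /= comp_polyX comp_polyC -opprD.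
by rewrite prodrN card_ord -signr_odd mo expr1 mulN1r opprK.
Qed.

Lemma sum_double (V : nmodType) (f : nat -> V) (n : nat) :
  \sum_(i < n.*2) f i = \sum_(i < n) (f i.*2 + f i.*2.+1).
Proof.
elim: n => [|n IH]; first by rewrite !big_ord0.
by rewrite doubleS !big_ord_recr /= IH addrA.
Qed.

Lemma odd_binomial (F : comNzRingType) (M : nat) (y : F) :
  (1 + y) ^+ M.*2.+1 - (1 - y) ^+ M.*2.+1 =
  2 * y * \sum_(j < M.+1) ('C(M.*2.+1, j.*2.+1))%:R * (y ^+ 2) ^+ j.
Proof.
rewrite !exprDn -sumrB -doubleS.
rewrite (sum_double (fun i => 1 ^+ (M.*2.+1 - i) * y ^+ i *+ 'C(M.*2.+1, i) -
  1 ^+ (M.*2.+1 - i) * (- y) ^+ i *+ 'C(M.*2.+1, i))).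
rewrite mulr_sumr; apply: eq_bigr => j _.
rewrite !expr1n !mul1r.
have e1 : (- y) ^+ j.*2 = y ^+ j.*2.
  by rewrite exprNn -signr_odd odd_double expr0 mul1r.
have e2 : (- y) ^+ j.*2.+1 = - y ^+ j.*2.+1.
  by rewrite !exprS e1 mulNr.
rewrite e1 e2 subrr add0r -exprM mul2n exprS -mulr_natr.
ring.
Qed.

(** * Factorization of (1 + y)^N - (1 - y)^N *)

Lemma cos_addi_sin_exp (R : realType) (x : R) (n : nat) :
  (cos x +i* sin x) ^+ n = cos (x *+ n) +i* sin (x *+ n) :> R[i].
Proof.
elim: n => [|n IH]; first by rewrite !mulr0n cos0 sin0 expr0.
rewrite exprS IH mulrS cosD sinD.
by apply/eqP; rewrite eq_complex /= eqxx /= addrC [sin x * _]mulrC mulrC eqxx.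
Qed.

(** The shift [k.+1] makes the indices [k < M] enumerate exactly the angles [pi j / N], [N = 2M+1],
    lying strictly between 0 and [pi/2]. *)
Definition tan_node (R : realType) (M k : nat) : R :=
  tan (pi * k.+1%:R / M.*2.+1%:R).

Lemma tan_node_itv (R : realType) (M k : nat) : (k < M)%N ->
  0 < (pi : R) * k.+1%:R / M.*2.+1%:R < pi / 2.
Proof.
move=> kM; have p0 := pi_gt0 R; apply/andP; split.
  by rewrite divr_gt0 ?mulr_gt0 ?ltr0n.
rewrite -mulrA ltr_pM2l // ltr_pdivrMr ?ltr0n // mulrC ltr_pdivlMr ?ltr0n //.
by rewrite -natrM ltr_nat; lia.
Qed.

(** Mean value theorem: the derivative [1 / cos^2] is at least 1. *)
Lemma le_tan (R : realType) (x : R) : 0 < x < pi / 2 -> x <= tan x.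
Proof.
move=> /andP[x0 xp]; have ci y : 0 <= y <= x -> 0 < cos y.
  by move=> /andP[y0 yx]; apply: cos_gt0_pihalf; have := pi_gt0 R; lra.
have [||c /itvP cI] := @MVT_segment R tan (fun y => (cos y) ^- 2) 0 x (ltW x0).
- by move=> y /itvP yI; apply: is_derive_tan; rewrite gt_eqF // ci // !yI.
- apply: derivable_within_continuous => y /itvP yI.
  by apply: derivable_tan; rewrite gt_eqF // ci // !yI.
rewrite tan0 !subr0 => ->; rewrite ler_peMl ?(ltW x0) //.
have c0 : 0 < cos c by rewrite ci // !cI.
by rewrite invf_ge1 ?exprn_gt0 // exprn_ile1 ?cos_le1 ?ltW.
Qed.

Lemma tan_node_ge (R : realType) (M k : nat) : (k < M)%N ->
  pi * k.+1%:R <= M.*2.+1%:R * tan_node R M k.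
Proof.
move=> kM; rewrite [leRHS]mulrC -ler_pdivrMr ?ltr0n //.
by rewrite le_tan // tan_node_itv.
Qed.

Lemma tan_node_gt0 (R : realType) (M k : nat) : (k < M)%N -> 0 < tan_node R M k.
Proof.
move=> kM; have xI := tan_node_itv R kM.
by apply: lt_le_trans (le_tan xI); case/andP: xI.
Qed.

(* For [t = tan_node R M k] and [N = 2M+1], [(1 + i t) ^ N = (1 - i t) ^ N]. *)
Lemma tan_node_root (R : realType) (M k : nat) : (k < M)%N ->
  \sum_(j < M.+1) ('C(M.*2.+1, j.*2.+1))%:R * (- tan_node R M k ^+ 2) ^+ j = 0.
Proof.
move=> kM; set x : R := pi * k.+1%:R / M.*2.+1%:R.
have t0 := tan_node_gt0 R kM.
have c0 : cos x != 0.
  have /andP[x0 xp] : 0 < x < pi / 2 := tan_node_itv R kM.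
  by rewrite gt_eqF // cos_gt0_pihalf //; have := pi_gt0 R; lra.
have sN : sin (x *+ M.*2.+1) = 0.
  rewrite -mulr_natr /x divfK ?pnatr_eq0 // mulr_natr.
  elim: k.+1 => [|k' IH]; first by rewrite mulr0n sin0.
  by rewrite mulrSr sinDpi IH oppr0.
(* Since [1 + i tan y = exp (i y) / cos y], de Moivre's formula reduces the N-th powers to [cos] and
   [sin] of [N x], a multiple of [pi]. *)
have d (y : R) : cos y != 0 ->
    1 + (tan y)%:C * 'i%C = ((cos y)^-1)%:C * (cos y +i* sin y).
  move=> cy; rewrite /tan; apply/eqP; rewrite eq_complex /=.
  by rewrite !(mul0r, mulr0, mulr1, subr0, addr0, add0r) mulVf // eqxx mulrC eqxx.
have d2 : 1 - (tan_node R M k)%:C * 'i%C =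
    ((cos x)^-1)%:C * (cos (- x) +i* sin (- x)).
  by rewrite -[in RHS]cosN -d ?cosN // tanN rmorphN mulNr.
have h : \sum_(j < M.+1) ('C(M.*2.+1, j.*2.+1))%:R *
    (((tan_node R M k)%:C * 'i%C) ^+ 2) ^+ j = 0.
  have := odd_binomial M ((tan_node R M k)%:C * 'i%C).
  rewrite [X in X ^+ _ - _](d x c0) d2 !exprMn !cos_addi_sin_exp.
  rewrite mulNrn cosN sinN sN oppr0 subrr.
  move/esym/eqP; rewrite !mulf_eq0 pnatr_eq0 /= => /orP[|/eqP //].
  rewrite !eq_complex /= eqxx oner_eq0 andbT andbF orbF => /eqP t00.
  by rewrite t00 ltxx in t0.
apply: complexI; rewrite rmorph0 -[RHS]h rmorph_sum; apply: eq_bigr => j _ /=.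
rewrite rmorphM rmorphXn rmorphN rmorph_nat /= rmorphXn.
by rewrite [(_ * 'i%C) ^+ 2]exprMn sqr_i mulrN1.
Qed.

(** The left-hand side has degree [M], leading coefficient [C(N, N) = 1] and the [M] distinct roots
    [- tan_node ^ 2], so it splits into linear factors. Its constant term [C(N, 1) = N] gives the
    normalization. *)
Lemma binomial_prod_tan (R : realType) (M : nat) :
  \poly_(j < M.+1) ('C(M.*2.+1, j.*2.+1))%:R =
  M.*2.+1%:R *: \prod_(k < M) (1 + (tan_node R M k) ^- 2 *: 'X) :> {poly R}.
Proof.
set q := (LHS); pose rs := [seq - tan_node R M k ^+ 2 | k <- index_iota 0 M].
have q1 : 'C(M.*2.+1, M.*2.+1)%:R = 1 :> R by rewrite binn.
have sq : size q = (size rs).+1.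
  by rewrite size_poly_eq ?q1 ?oner_eq0 // size_map size_iota subn0.
have rq : all (root q) rs.
  apply/allP => x /mapP[k]; rewrite mem_index_iota => /andP[_ kM] ->.
  by rewrite /root horner_poly tan_node_root.
have ti k : (k < M)%N -> (pi : R) * k.+1%:R / M.*2.+1%:R \in `](-(pi/2)), (pi/2)[.
  move=> kM; have /andP[h1 h2] := tan_node_itv R kM.
  by rewrite in_itv /= h2 andbT (lt_trans _ h1) // oppr_lt0 divr_gt0 ?pi_gt0.
have uq : uniq_roots rs.
  rewrite uniq_rootsE map_inj_in_uniq ?iota_uniq // => i j.
  rewrite !mem_index_iota /= => iM jM /oppr_inj /eqP.
  rewrite eqrXn2 ?ltW ?tan_node_gt0 // => /eqP.
  move/(tan_inj (ti _ iM) (ti _ jM)).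
  move/eqP; rewrite (inj_eq (divIf _)) ?pnatr_eq0 //.
  have pi0 : (pi : R) != 0 by rewrite gt_eqF ?pi_gt0.
  rewrite (inj_eq (mulfI pi0)) eqr_nat.
  by move/eqP => [].
have := all_roots_prod_XsubC sq rq uq.
rewrite lead_coef_poly ?q1 ?oner_eq0 // scale1r big_map.
rewrite big_mkord => qE.
have qE' : q = (\prod_(k < M) tan_node R M k ^+ 2) *:
    \prod_(k < M) (1 + (tan_node R M k) ^- 2 *: 'X).
  rewrite qE -mul_polyC rmorph_prod -big_split /=; apply: eq_bigr => k _.
  rewrite mulrDr mulr1 mul_polyC scalerA divff ?scale1r; last first.
    by rewrite expf_neq0 // gt_eqF // tan_node_gt0.
  by rewrite polyCN opprK addrC.
rewrite {1}qE'; congr (_ *: _).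
(* Evaluation at 0 identifies the product of the squared nodes with [N]. *)
have /(congr1 (fun p => p.[0])) := qE'.
rewrite horner_poly hornerZ.
rewrite big_ord_recl big1 ?addr0; last by move=> i _; rewrite expr0n mulr0.
rewrite expr0 mulr1 bin1 => ->.
rewrite horner_prod [X in _ = _ * X]big1 ?mulr1 // => i _.
by rewrite hornerD hornerZ hornerX hornerE mulr0 addr0.
Qed.

Lemma pow_diff_tan (R : realType) (M : nat) (y : {poly R[i]}) :
  (1 + y) ^+ M.*2.+1 - (1 - y) ^+ M.*2.+1 =
  (2 * M.*2.+1%:R) *: y * \prod_(k < M) (1 + ((tan_node R M k) ^- 2)%:C *: y ^+ 2).
Proof.
rewrite odd_binomial.
have /(congr1 (fun p => map_poly (real_complex R) p \Po (y ^+ 2))) :=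
  binomial_prod_tan R M.
rewrite poly_def !rmorph_sum /= map_polyZ /= comp_polyZ !rmorph_prod /=.
under eq_bigr do
  rewrite map_polyZ /= map_polyXn comp_polyZ rmorphXn /= comp_polyX -mul_polyC.
under [in X in _ = X -> _]eq_bigr do
  rewrite rmorphD rmorph1 /= map_polyZ map_polyX rmorphD rmorph1 /= comp_polyZ comp_polyX.
move=> h; transitivity (2 * y * (M.*2.+1%:R *:
    \prod_(k < M) (1 + ((tan_node R M k) ^- 2)%:C *: y ^+ 2))); last first.
  by rewrite -!mul_polyC polyCM !polyC_natr; ring.
congr (_ * _); rewrite rmorph_nat in h; rewrite -[RHS]h.
by apply: eq_bigr => j _; rewrite rmorph_nat polyC_natr.
Qed.

Lemma prod_pow_diff (R : realType) (m M : nat) (w : R[i]) :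
  odd m -> m.-primitive_root w ->
  \prod_(j < m) ((1 + (w ^+ j / M.*2.+1%:R) *: 'X) ^+ M.*2.+1 -
                 (1 - (w ^+ j / M.*2.+1%:R) *: 'X) ^+ M.*2.+1) =
  (2 ^+ m) *: 'X^m * (map_poly (real_complex R)
     (\prod_(k < M) (1 + (M.*2.+1%:R * tan_node R M k) ^- (2 * m) *: 'X))
     \Po 'X^(2 * m)).
Proof.
(* As [m] is odd, squaring permutes the m-th roots of unity; for each fixed node the product over
   [j] therefore collapses. *)
move=> mo wp; have w2p : m.-primitive_root (w ^+ 2).
  by rewrite prim_root_exp_coprime // coprime2n.
have N0 : M.*2.+1%:R != 0 :> R[i] by rewrite pnatr_eq0.
transitivity (\prod_(j < m) ((2 * w ^+ j) *: 'X * \prod_(k < M)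
   (1 + (w ^+ 2) ^+ j *: (((M.*2.+1%:R * tan_node R M k) ^- 2)%:C *: 'X^2)))).
  apply: eq_bigr => j _; rewrite pow_diff_tan; congr (_ * _).
    by rewrite scalerA; congr (_ *: _); field.
  apply: eq_bigr => k _; congr (1 + _).
  have := tan_node_gt0 R (ltn_ord k); move: (tan_node R M k) => t t_gt0.
  rewrite exprZn !scalerA; congr (_ *: _).
  rewrite !fmorphV !rmorphXn rmorphM rmorph_nat /= exprAC.
  have t0 : t%:C != 0 by rewrite (inj_eq (@complexI _)) gt_eqF.
  by move: M.*2.+1%:R N0 => N N0; field; rewrite N0 t0.
rewrite big_split /= exchange_big /=; congr (_ * _).
  under eq_bigr do rewrite -mul_polyC.
  rewrite big_split /= prodr_const card_ord -rmorph_prod big_split /= prodr_const.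
  by rewrite card_ord prod_prim_root // mulr1 mul_polyC.
rewrite !rmorph_prod /=; apply: eq_bigr => k _.
rewrite prod_1add_prim_root // rmorphD rmorph1 /= map_polyZ /= map_polyX.
rewrite rmorphD rmorph1 /= comp_polyZ comp_polyX exprZn -exprM; congr (1 + _ *: _).
by rewrite -rmorphXn /= -exprVn -exprM exprVn.
Qed.

Lemma coef_prod_pow_diff (R : realType) (m M n : nat) (w : R[i]) :
  odd m -> m.-primitive_root w ->
  (\prod_(j < m) ((1 + (w ^+ j / M.*2.+1%:R) *: 'X) ^+ M.*2.+1 -
                 (1 - (w ^+ j / M.*2.+1%:R) *: 'X) ^+ M.*2.+1))`_(2 * m * n + m) =
  2 ^+ m * (\sum_(A : {set 'I_M} | #|A| == n)
     \prod_(k in A) (M.*2.+1%:R * tan_node R M k) ^- (2 * m))%:C.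
Proof.
move=> mo wp; have m0 : (0 < 2 * m)%N by case: m mo {wp}.
(* The factor [X^m] removes [m] from the exponent, and composition with [X^(2m)] turns [2mn] into
   [n]. *)
rewrite prod_pow_diff // -scalerAl coefZ coefXnM ltnNge leq_addl /= addnK.
by rewrite coef_comp_poly_Xn // dvdn_mulr // mulKn // coef_map coef_prod_1addZX.
Qed.

(** * Convergence of coefficients *)

(** Convergence is taken componentwise, so that only limits of real sequences occur. *)
Definition complex_cvg (R : realType) (u : nat -> R[i]) (l : R[i]) :=
  (complex.Re (u k) @[k --> \oo] --> complex.Re l /\
   complex.Im (u k) @[k --> \oo] --> complex.Im l)%classic.

Lemma complex_cvg_cst (R : realType) (l : R[i]) : complex_cvg (fun=> l) l.
Proof. by split; exact: cvg_cst. Qed.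

Lemma complex_cvgD (R : realType) (u v : nat -> R[i]) (a b : R[i]) :
  complex_cvg u a -> complex_cvg v b -> complex_cvg (fun k => u k + v k) (a + b).
Proof.
have DE (x y : R[i]) : x + y =
    (complex.Re x + complex.Re y) +i* (complex.Im x + complex.Im y).
  by case: x; case: y.
move=> [ur ui] [vr vi]; split; under eq_fun do rewrite DE; rewrite DE /=.
  exact: cvgD.
exact: cvgD.
Qed.

Lemma complex_cvgM (R : realType) (u v : nat -> R[i]) (a b : R[i]) :
  complex_cvg u a -> complex_cvg v b -> complex_cvg (fun k => u k * v k) (a * b).
Proof.
have ME (x y : R[i]) : x * y =
    (complex.Re x * complex.Re y - complex.Im x * complex.Im y)
    +i* (complex.Re x * complex.Im y + complex.Im x * complex.Re y).
  by case: x; case: y.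
move=> [ur ui] [vr vi]; split; under eq_fun do rewrite ME; rewrite ME /=.
  by apply: cvgB; apply: cvgM.
by apply: cvgD; apply: cvgM.
Qed.

Lemma complex_cvg_sum (R : realType) (I : Type) (r : seq I) (P : pred I)
    (u : I -> nat -> R[i]) (a : I -> R[i]) :
  (forall i, complex_cvg (u i) (a i)) ->
  complex_cvg (fun k => \sum_(i <- r | P i) u i k) (\sum_(i <- r | P i) a i).
Proof.
move=> ua; elim: r => [|i r IH].
  rewrite big_nil; under eq_fun do rewrite big_nil.
  exact: complex_cvg_cst.
rewrite big_cons; under eq_fun do rewrite big_cons.
by case: (P i) => //; apply: complex_cvgD.
Qed.

Lemma complex_cvg_real (R : realType) (u : nat -> R) (l : R) :
  (u k @[k --> \oo] --> l)%classic -> complex_cvg (fun k => (u k)%:C) l%:C.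
Proof. by move=> ul; split => //=; exact: cvg_cst. Qed.

Lemma cvg_inv_odd (R : realType) :
  ((k.*2.+1%:R : R)^-1 @[k --> \oo] --> (0 : R))%classic.
Proof.
apply: (@squeeze_cvgr _ _ _ _ (fun=> 0) harmonic); last 2 first.
- exact: cvg_cst.
- exact: cvg_harmonic.
near=> k; rewrite invr_ge0 ler0n /= /harmonic lef_pV2 ?posrE ?ltr0n //.
by rewrite ler_nat; lia.
Unshelve. all: by end_near. Qed.

Lemma cvg_ffact_odd (R : realType) (l : nat) :
  ((k.*2.+1 ^_ l)%:R / k.*2.+1%:R ^+ l @[k --> \oo] --> (1 : R))%classic.
Proof.
elim: l => [|l IH].
  by under eq_fun do rewrite ffactn0 expr0 divr1; exact: cvg_cst.
have : ((k.*2.+1 ^_ l)%:R / k.*2.+1%:R ^+ l * (1 - l%:R * k.*2.+1%:R^-1)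
    @[k --> \oo] --> (1 * (1 - l%:R * 0) : R))%classic.
  apply: cvgM => //; apply: cvgB; first exact: cvg_cst.
  by apply: cvgM; [exact: cvg_cst | exact: cvg_inv_odd].
rewrite mulr0 subr0 mulr1; apply: cvg_trans; apply: near_eq_cvg.
(* The new factor of the falling factorial is a truncated subtraction, equal to [N - l] in the reals
   once [l <= N]; hence equality holds only eventually. *)
near=> k; rewrite ffactnSr natrM natrB; last first.
  by apply: (@leq_trans k); [near: k; exact: nbhs_infty_ge | lia].
have N0 : k.*2.+1%:R != 0 :> R by rewrite pnatr_eq0.
by rewrite exprSr; move: k.*2.+1%:R N0 => N N0; field; rewrite N0 ?expf_neq0.
Unshelve. all: by end_near. Qed.

(** Coefficientwise convergence to the formal power series [exp (a X)]. *)
Definition coef_cvg_exp (R : realType) (u : nat -> {poly R[i]}) (a : R[i]) :=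
  forall l, complex_cvg (fun M => (u M)`_l) (a ^+ l / l`!%:R).

Lemma coef_cvg_exp1 (R : realType) : @coef_cvg_exp R (fun=> 1) 0.
Proof.
move=> l; under eq_fun do rewrite coef1.
have -> : 0 ^+ l / l`!%:R = (l == 0%N)%:R :> R[i].
  by rewrite expr0n; case: l => [|l]; rewrite ?mul0r // fact0 divr1.
exact: complex_cvg_cst.
Qed.

(** This is [exp (a X) exp (b X) = exp ((a + b) X)]: the binomial formula divided by [l!] is the
    Cauchy product. *)
Lemma coef_cvg_expM (R : realType) (u v : nat -> {poly R[i]}) (a b : R[i]) :
  coef_cvg_exp u a -> coef_cvg_exp v b ->
  coef_cvg_exp (fun M => u M * v M) (a + b).
Proof.
move=> ua vb l; under eq_fun do rewrite coefM.
have -> : (a + b) ^+ l / l`!%:R =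
    \sum_(j < l.+1) (a ^+ j / j`!%:R) * (b ^+ (l - j) / (l - j)`!%:R) :> R[i].
  rewrite addrC exprDn mulr_suml; apply: eq_bigr => j _.
  have jl : (j <= l)%N by rewrite -ltnS.
  have f0 n : n`!%:R != 0 :> R[i] by rewrite pnatr_eq0 -lt0n fact_gt0.
  rewrite -mulr_natr -(bin_fact jl) !natrM.
  have b0 : 'C(l, j)%:R != 0 :> R[i] by rewrite pnatr_eq0 -lt0n bin_gt0.
  move: (f0 j) (f0 (l - j)%N); move: (j`!%:R) ((l - j)`!%:R) => x y x0 y0.
  move: ('C(l, j)%:R) b0 (a ^+ j) (b ^+ (l - j)) => c c0 a' b'.
  by field; rewrite x0 y0 c0.
by apply: complex_cvg_sum => j; apply: complex_cvgM.
Qed.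

Lemma coef_cvg_exp_prod (R : realType) (I : finType)
    (u : I -> nat -> {poly R[i]}) (a : I -> R[i]) :
  (forall i, coef_cvg_exp (u i) (a i)) ->
  coef_cvg_exp (fun M => \prod_i u i M) (\sum_i a i).
Proof.
move=> ua; elim: (index_enum I) => [|i r IH].
  rewrite big_nil; have -> : (fun M => \prod_(i <- [::]) u i M) = fun=> 1.
    by apply/funext => M; rewrite big_nil.
  exact: coef_cvg_exp1.
rewrite big_cons; have -> : (fun M => \prod_(j <- i :: r) u j M) =
    fun M => u i M * \prod_(j <- r) u j M.
  by apply/funext => M; rewrite big_cons.
exact: coef_cvg_expM.
Qed.

(** The formal version of [(1 + a X / N)^N -> exp (a X)]: the coefficient is [a^l / l!] times the
    ratio of the falling factorial to [N^l], which tends to 1. *)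
Lemma coef_cvg_exp_pow (R : realType) (a : R[i]) :
  coef_cvg_exp (fun M => (1 + (a / M.*2.+1%:R) *: 'X) ^+ M.*2.+1) a.
Proof.
move=> l; have coefE M : ((1 + (a / M.*2.+1%:R) *: 'X) ^+ M.*2.+1)`_l =
    ((M.*2.+1 ^_ l)%:R / M.*2.+1%:R ^+ l : R)%:C * (a ^+ l / l`!%:R).
  rewrite exprDn coef_sum.
  under eq_bigr do rewrite expr1n mul1r exprZn coefMn coefZ coefXn.
  have -> : ((M.*2.+1 ^_ l)%:R / M.*2.+1%:R ^+ l : R)%:C * (a ^+ l / l`!%:R) =
     (a / M.*2.+1%:R) ^+ l *+ 'C(M.*2.+1, l).
    rewrite rmorphM fmorphV rmorphXn !rmorph_nat /= -bin_ffact natrM -[RHS]mulr_natr.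
    rewrite expr_div_n.
    have : l`!%:R != 0 :> R[i] by rewrite pnatr_eq0 -lt0n fact_gt0.
    have : M.*2.+1%:R ^+ l != 0 :> R[i] by rewrite expf_neq0 // pnatr_eq0.
    move: (l`!%:R) (M.*2.+1%:R ^+ l) ('C(_, _)%:R) (a ^+ l) => x y c b y0 x0.
    by field; rewrite x0 y0.
  have [lM|lM] := ltnP l M.*2.+2.
    rewrite (bigD1 (Ordinal lM)) //= eqxx mulr1 big1 ?addr0 // => i il.
    by rewrite eq_sym -val_eqE /= in il *; rewrite (negPf il) mulr0 mul0rn.
  rewrite bin_small // mulr0n big1 // => i _.
  by rewrite gtn_eqF ?mulr0 ?mul0rn // (leq_trans (ltn_ord i)).
under eq_fun do rewrite coefE.
rewrite -[X in complex_cvg _ X]mul1r; apply: complex_cvgM.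
  exact: (complex_cvg_real (cvg_ffact_odd l)).
exact: complex_cvg_cst.
Qed.

Lemma coef_prod_pow_diff_cvg (R : realType) (m L : nat) (a : 'I_m -> R[i]) :
  complex_cvg (fun M => (\prod_(j < m)
     ((1 + (a j / M.*2.+1%:R) *: 'X) ^+ M.*2.+1 -
      (1 - (a j / M.*2.+1%:R) *: 'X) ^+ M.*2.+1))`_L)
  (\sum_(A : {set 'I_m}) (-1) ^+ #|~: A| *
     ((\sum_j (if j \in A then a j else - a j)) ^+ L / L`!%:R)).
Proof.
(* Both terms of a factor are values of [u], at [a j] and at [- a j], so each choice [A] yields a
   product of powers tending to an exponential. *)
pose u c M := (1 + (c / M.*2.+1%:R) *: 'X) ^+ M.*2.+1 : {poly R[i]}.
have -> : (fun M => (\prod_(j < m)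
     ((1 + (a j / M.*2.+1%:R) *: 'X) ^+ M.*2.+1 -
      (1 - (a j / M.*2.+1%:R) *: 'X) ^+ M.*2.+1))`_L) =
  (fun M => \sum_(A : {set 'I_m}) (-1) ^+ #|~: A| *
     (\prod_j u (if j \in A then a j else - a j) M)`_L).
  apply/funext => M; rewrite bigA_distr coef_sum; apply: eq_bigr => A _.
  have -> : (-1) ^+ #|~: A| = \prod_j (if j \in A then 1 else -1) :> R[i].
    rewrite -prodr_const big_mkcond; apply: eq_bigr => j _.
    by rewrite inE; case: (j \in A).
  rewrite -coefCM rmorph_prod -big_split; congr ((_ : {poly _})`_L).
  apply: eq_bigr => j _ /=.
  case: (j \in A) => /=; first by rewrite polyC1 mul1r.
  by rewrite polyCN polyC1 mulN1r /u mulNr scaleNr.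
apply: complex_cvg_sum => A; apply: complex_cvgM; first exact: complex_cvg_cst.
by apply: coef_cvg_exp_prod => j; exact: coef_cvg_exp_pow.
Qed.

(** * Signed sums over subsets *)

Lemma sum_symmetric (V : nmodType) (f : nat -> V) (h : nat) :
  (forall r, (r <= h)%N -> f (h.*2.+1 - r)%N = f r) ->
  \sum_(r < h.+1.*2) f r = (\sum_(r < h.+1) f r) *+ 2.
Proof.
move=> fE; rewrite -addnn big_split_ord /= mulr2n; congr (_ + _).
rewrite (reindex_inj rev_ord_inj) /=; apply: eq_bigr => r _.
rewrite -[RHS]fE; last by rewrite -ltnS.
by congr f; have := ltn_ord r; lia.
Qed.

(* Complementing [A] changes the sign of both factors, [m] and [L] being odd, so
   the subsets of size at most [m.-1./2] contribute half of the sum. *)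
Lemma signed_subset_sum (F : comNzRingType) (m L : nat) (x : 'I_m -> F) :
  odd m -> odd L -> \sum_j x j = 0 ->
  \sum_(A : {set 'I_m}) (-1) ^+ #|~: A| *
     (\sum_j (if j \in A then x j else - x j)) ^+ L =
  2 ^+ L * (2 * \sum_(1 <= r < (m.-1./2).+1) (-1) ^+ r.-1 *
     \sum_(A : {set 'I_m} | #|A| == r) (\sum_(j in A) x j) ^+ L).
Proof.
move=> mo Lo x0; pose s (A : {set 'I_m}) := \sum_(j in A) x j.
have sC A : s (~: A) = - s A.
  apply/eqP; rewrite -addr_eq0 addrC; apply/eqP; rewrite -[RHS]x0 /s.
  rewrite [RHS](bigID [in A]) /=; congr (_ + _).
  by apply: eq_bigl => j; rewrite inE.
(* The total being zero, subtracting the sum over the complement adds [s A] a second time. *)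
have sE (A : {set 'I_m}) : \sum_j (if j \in A then x j else - x j) = 2 * s A.
  rewrite (bigID [in A]) /= (eq_bigr x); last by move=> j ->.
  rewrite [X in _ + X](eq_bigr (fun j => - x j)); last by move=> j /negPf ->.
  rewrite sumrN mulr2n mulrDl mul1r; congr (_ + _).
  rewrite -[RHS]opprK -sC; congr (- _).
  by apply: eq_bigl => j; rewrite inE.
have cC (A : {set 'I_m}) : #|~: A| = (m - #|A|)%N.
  by rewrite cardsCs finset.setCK card_ord.
have cM (A : {set 'I_m}) : (#|A| <= m)%N by rewrite -[leqRHS]card_ord max_card.
have [h hE] : exists h, m = h.*2.+1.
  by exists m./2; rewrite -[LHS]odd_double_half mo.
pose S (r : nat) : F := \sum_(A : {set 'I_m} | #|A| == r) s A ^+ L.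
have SC r : (r <= m)%N -> S (m - r)%N = - S r.
  move=> rm; rewrite /S (reindex_inj (inv_inj (@finset.setCK _))) /= -sumrN.
  apply: eq_big => [A|A _]; last by rewrite sC exprNn -signr_odd Lo expr1 mulN1r.
  rewrite cC; apply/eqP/eqP => [h1|->//].
  by rewrite -(subKn (cM A)) h1 subKn.
transitivity (2 ^+ L * \sum_(r < h.+1.*2) (-1) ^+ (m - r) * S r).
  rewrite mulr_sumr.
  (* Subsets are grouped by cardinality; [inord] is faithful here, since the [m + 1 = 2(h + 1)]
     possible sizes fill the ordinal type. *)
  rewrite (partition_big (fun A : {set 'I_m} => inord #|A| : 'I_(h.+1.*2)) xpredT) //=.
  apply: eq_bigr => r _.
  have PE (A : {set 'I_m}) : (inord #|A| == r) = (#|A| == r).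
    by rewrite -val_eqE /= inordK // ltnS -hE cM.
  rewrite (eq_bigl _ _ PE) /S !mulr_sumr; apply: eq_bigr => A /eqP <-.
  by rewrite sE exprMn cC mulrCA.
rewrite (@sum_symmetric _ (fun r => (-1) ^+ (m - r) * S r)); last first.
  move=> r rh; rewrite -hE SC; last by lia.
  rewrite subKn; last by lia.
  rewrite -(signr_odd _ r) -(signr_odd _ (m - r)) oddB; last by lia.
  by rewrite mo; case: (odd r); rewrite /= ?expr0 ?expr1; ring.
congr (_ * _); rewrite -[LHS]mulr_natl; congr (_ * _).
(* The empty set contributes [0 ^+ L = 0], as [L] is odd, so the sum may start at [r = 1]. *)
rewrite big_ord_recl /= {1}/S (big_pred1 finset.set0); last first.
  by move=> A; rewrite cards_eq0.
rewrite {1}/s big_set0 expr0n; have -> : (L == 0)%N = false by case: L Lo {S SC sE}.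
rewrite mulr0 add0r big_add1 /= big_mkord.
have -> : m.-1./2 = h by rewrite hE /= doubleK.
apply: eq_bigr => r _; congr (_ * _).
have rm : (r.+1 <= m)%N.
  by rewrite hE ltnS (leq_trans (ltnW (ltn_ord r))) // -addnn leq_addr.
by rewrite -signr_odd -[RHS]signr_odd oddB // mo /= negbK.
Qed.

(** * Elementary symmetric sums and the multiple zeta value *)

Local Open Scope classical_set_scope.

(** The [n]-th elementary symmetric polynomial in [f 0, ..., f (K-1)]; as a coefficient it satisfies
    a recursion in [K] at once. *)
Definition elsym (R : realType) (f : nat -> R) (K n : nat) : R :=
  (\prod_(k < K) (1 + f k *: 'X))`_n.

Lemma elsym0 (R : realType) (f : nat -> R) (n : nat) : elsym f 0 n = (n == 0%N)%:R.
Proof. by rewrite /elsym big_ord0 coef1. Qed.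

Lemma elsymS (R : realType) (f : nat -> R) (K n : nat) :
  elsym f K.+1 n = elsym f K n + f K * (if n is n'.+1 then elsym f K n' else 0).
Proof.
rewrite /elsym big_ord_recr /= mulrDr mulr1 coefD -scalerAr coefZ coefMX.
by case: n.
Qed.

Lemma elsymE (R : realType) (f : nat -> R) (K n : nat) :
  elsym f K n = \sum_(A : {set 'I_K} | #|A| == n) \prod_(k in A) f k.
Proof. exact: (coef_prod_1addZX (fun k : 'I_K => f k)). Qed.

Lemma elsym_ge0 (R : realType) (f : nat -> R) (K n : nat) :
  (forall k, (k < K)%N -> 0 <= f k) -> 0 <= elsym f K n.
Proof.
by move=> f0; rewrite elsymE sumr_ge0 // => A _; apply: prodr_ge0 => k _; exact: f0.
Qed.

Lemma le_elsym (R : realType) (f g : nat -> R) (K n : nat) :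
  (forall k, (k < K)%N -> 0 <= f k <= g k) -> elsym f K n <= elsym g K n.
Proof.
move=> fg; rewrite !elsymE; apply: ler_sum => A _.
by apply: ler_prod => k _; exact: fg.
Qed.

Lemma elsym_widen (R : realType) (f : nat -> R) (K M n : nat) :
  (forall k, (k < M)%N -> 0 <= f k) -> (K <= M)%N -> elsym f K n <= elsym f M n.
Proof.
move=> f0 KM; move: f0; rewrite -(subnKC KM); move: (M - K)%N => d.
elim: d => [|d IH] f0; first by rewrite addn0.
have f0' k : (k < K + d)%N -> 0 <= f k by move=> kd; apply: f0; lia.
rewrite addnS elsymS; apply: le_trans (IH f0') _.
rewrite lerDl mulr_ge0 //; first by apply: f0; lia.
by case: n {IH} => // n; exact: elsym_ge0.
Qed.

Lemma elsymZ (R : realType) (c : R) (f : nat -> R) (K n : nat) :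
  elsym (fun k => c * f k) K n = c ^+ n * elsym f K n.
Proof.
rewrite !elsymE mulr_sumr; apply: eq_bigr => A /eqP <-.
by rewrite big_split /= prodr_const.
Qed.

Lemma cvg_elsym (R : realType) (u : nat -> nat -> R) (f : nat -> R) (K n : nat) :
  (forall k, u M k @[M --> \oo] --> f k) ->
  elsym (u M) K n @[M --> \oo] --> elsym f K n.
Proof.
move=> uf; elim: K n => [|K IH] n.
  by under eq_fun do rewrite elsym0; rewrite elsym0; exact: cvg_cst.
under eq_fun do rewrite elsymS; rewrite elsymS; apply: cvgD => //.
by apply: cvgM => //; case: n => [|n]; [exact: cvg_cst | exact: IH].
Qed.

(** Ordinals start at 0 and the summation indices at 1; after the shift the condition [0 < k_1] is
    automatic. *)
Definition succ_tuple (n K : nat) (t : n.-tuple 'I_K) : n.-tuple nat :=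
  map_tuple (fun i : 'I_K => i.+1) t.

Lemma succ_tuple_inj (n K : nat) : injective (@succ_tuple n K).
Proof.
move=> t u /(congr1 val) /= tu; apply: val_inj; apply: inj_map tu.
by move=> i j [] /val_inj.
Qed.

Lemma path_succ_tuple (n K : nat) (t : n.-tuple 'I_K) :
  path ltn 0 (succ_tuple t) = sorted ltn (map val t).
Proof.
rewrite /= -[map _ t]/(map (succn \o val) t) map_comp.
case: (map val t) => //= x s; rewrite path_map.
by apply: eq_path => i j.
Qed.

Lemma elsym_tuple (R : realType) (s K n : nat) :
  elsym (fun k => k.+1%:R ^- s : R) K n =
  \sum_(t : n.-tuple 'I_K | sorted ltn (map val t))
    (\prod_(i < n) (tnth (succ_tuple t) i)%:R) ^- s.
Proof.
rewrite elsymE -sum_sorted_tuple; apply: eq_bigr => t /sorted_map_val_uniq ut.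
rewrite -prodrXl -prodfV; under [RHS]eq_bigr do rewrite tnth_map.
by rewrite (big_tnth_set _ (fun k : 'I_K => k.+1%:R ^- s) ut).
Qed.

Section MzvBounds.
Variables (R : realType) (s n : nat).

Let F (k : n.-tuple nat) : \bar R :=
  ((\prod_(i < n) (tnth k i)%:R) ^- s : R)%:E.

(** The truncation [k_n <= K] of the index set; its partial sum is an [elsym]. *)
Let X (K : nat) : set (n.-tuple nat) :=
  @succ_tuple n K @` [set` [pred t : n.-tuple 'I_K | sorted ltn (map val t)]].

Let F_ge0 k : (0 <= F k)%E.
Proof. by rewrite lee_fin invr_ge0 exprn_ge0 // prodr_ge0. Qed.

Let finX K : finite_set (X K).
Proof. by apply: finite_image; exact: finite_finset. Qed.

Let sum_X K : (\sum_(k \in X K) F k)%E = (elsym (fun k => k.+1%:R ^- s : R) K n)%:E.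
Proof.
rewrite fsbig_image; last by move=> t u _ _; exact: succ_tuple_inj.
rewrite -(@bigfs _ _ _ _ (index_enum _)) ?index_enum_uniq //; last first.
  by move=> i _; rewrite mem_index_enum.
by rewrite elsym_tuple -sumEFin.
Qed.

Lemma elsym_le_mzv (K : nat) :
  ((elsym (fun k => k.+1%:R ^- s : R) K n)%:E <= mzv_rep R s n)%E.
Proof.
apply: esum_ge; exists (X K); last by rewrite -sum_X.
split; first exact: finX.
by move=> _ [t /= st <-]; rewrite -/(succ_tuple t) path_succ_tuple.
Qed.

(** The sum is a supremum over finite sets of tuples, and each such set lies in some truncation
    [X]. *)
Lemma mzv_le (L : R) : (forall K, elsym (fun k => k.+1%:R ^- s : R) K n <= L) ->
  (mzv_rep R s n <= L%:E)%E.
Proof.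
move=> eL; apply: ge_ereal_sup => _ [Y [finY Yp] <-].
have [r rE] := (finite_seqP Y).1 finY.
(* A crude bound for all entries: each is at most the sum of its tuple. *)
pose K := \max_(k <- r) sumn k.
have kK k : k \in r -> forall x, x \in tval k -> (x <= K)%N.
  move=> kr x xk; apply: leq_trans (leq_bigmax_seq _ kr isT).
  elim: (tval k) xk => //= y z IH; rewrite inE => /orP[/eqP ->|/IH xz].
    exact: leq_addr.
  exact: leq_trans xz (leq_addl _ _).
apply: (@le_trans _ _ (\sum_(k \in X K.+1) F k)%E); last first.
  by rewrite sum_X lee_fin.
apply: lee_fsum_nneg_subset; [exact: finY | exact: finX | | by move=> k _; exact: F_ge0].
move=> k; rewrite !inE => Yk; have pk := Yp _ Yk.
have kr : k \in r by move: Yk; rewrite rE.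
have k0 x : x \in tval k -> (0 < x)%N.
  by move=> xk; have /allP := order_path_min ltn_trans pk; exact.
pose t := map_tuple (fun x => inord x.-1 : 'I_K.+1) k.
have tk : succ_tuple t = k.
  apply: val_inj; rewrite /= -map_comp map_id_in // => x xk /=.
  by rewrite inordK prednK ?k0 // leqW // (kK k).
have st : sorted ltn (map val t) by rewrite -path_succ_tuple tk.
by exists t.
Qed.

End MzvBounds.

(** The derivative of [tan] at 0 is 1; it is used along the nonzero sequence [pi (k+1) / N], which
    tends to 0. *)
Lemma cvg_tan_node (R : realType) (k : nat) :
  M.*2.+1%:R * tan_node R M k @[M --> \oo] --> pi * k.+1%:R.
Proof.
have := is_derive_tan (x := 0 : R); rewrite cos0 oner_eq0 => /(_ isT) dt.
have dc : (fun h => tan h / h) @ (0 : R)^' --> (1 : R).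
  have := @ex_derive _ _ _ _ _ _ _ dt; rewrite /derivable => /cvg_ex[l lP].
  have := @derive_val _ _ _ _ _ _ _ dt; rewrite /derive (cvg_lim _ lP) // => l1.
  rewrite expr1n invr1 in l1; rewrite -l1; apply: cvg_trans lP.
  by apply: near_eq_cvg; near=> h; rewrite /= tan0 subr0 addr0 [h *: 1]mulr1 [RHS]mulrC.
pose h M : R := pi * k.+1%:R / M.*2.+1%:R.
have c0 : (pi * k.+1%:R : R) != 0 by rewrite mulf_neq0 // gt_eqF // pi_gt0.
have h0 M : h M != 0 by rewrite mulf_neq0 // invr_eq0 pnatr_eq0.
have hc : h M @[M --> \oo] --> (0 : R).
  rewrite -[X in _ --> X](mulr0 (pi * k.+1%:R)); apply: cvgM; first exact: cvg_cst.
  exact: cvg_inv_odd.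
have := (cvgr_dnbhsP _ _ _).1 dc h (conj h0 hc) => th.
rewrite -[X in _ --> X]mulr1.
have -> : (fun M => M.*2.+1%:R * tan_node R M k) =
    (fun M => (pi * k.+1%:R) * (tan (h M) / h M)).
  apply/funext => M; rewrite /tan_node -/(h M); move: (tan (h M)) => T.
  have N0 : M.*2.+1%:R != 0 :> R by rewrite pnatr_eq0.
  by rewrite /h; move: M.*2.+1%:R N0 (pi * _) c0 => N N0 c c0'; field; rewrite N0 c0'.
by apply: cvgM => //; exact: cvg_cst.
Unshelve. all: by end_near. Qed.

(* Since [N tan(pi k / N) >= pi k], the finite symmetric sums lie below their
   limits, so existence of the limit [l] makes dominated convergence unnecessary. *)
Lemma mzv_of_cvg (R : realType) (s n : nat) (l : R) :
  elsym (fun k => (M.*2.+1%:R * tan_node R M k) ^- s) M n @[M --> \oo] --> l ->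
  mzv_rep R s n = (pi ^+ (s * n) * l)%:E.
Proof.
pose x M k : R := (M.*2.+1%:R * tan_node R M k) ^- s.
pose b k : R := k.+1%:R ^- s.
move=> xl; have p0 : 0 < pi ^+ s :> R by rewrite exprn_gt0 // pi_gt0.
have pn0 : 0 < pi ^+ (s * n) :> R by rewrite exprn_gt0 // pi_gt0.
have bE k : pi ^- s * b k = (pi * k.+1%:R) ^- s by rewrite exprMn invfM.
have x0 M k : (k < M)%N -> 0 <= x M k.
  move=> kM; rewrite /x invr_ge0 exprn_ge0 // mulr_ge0 // ltW //.
  exact: tan_node_gt0.
have xb M k : (k < M)%N -> 0 <= x M k <= pi ^- s * b k.
  move=> kM; rewrite x0 //= bE /x.
  have pk : 0 < pi * k.+1%:R :> R by rewrite mulr_gt0 // pi_gt0.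
  have tk := tan_node_ge R kM.
  rewrite lef_pV2 ?posrE ?exprn_gt0 //; last exact: lt_le_trans tk.
  by rewrite lerXn2r // nnegrE ltW // (lt_le_trans pk).
have up K : elsym b K n <= pi ^+ (s * n) * l.
  rewrite -ler_pdivrMl // exprM -exprVn -elsymZ.
  have xc : elsym (x M) K n @[M --> \oo] --> elsym (fun k => pi ^- s * b k) K n.
    apply: cvg_elsym => k; rewrite bE; apply: cvgV.
      by rewrite expf_neq0 // gt_eqF // mulr_gt0 // pi_gt0.
    apply: (@continuous_cvg _ _ _ _ _ _ (fun y : R => y ^+ s)).
      exact: exprn_continuous.
    exact: cvg_tan_node.
  apply: (ler_cvg_to xc xl).
  (* Here [K] is fixed: once [M >= K], the sum over the first [K] nodes is at most the full one,
     which tends to [l]. *)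
  near=> M; apply: elsym_widen; first exact: x0.
  by near: M; exact: nbhs_infty_ge.
have mL := mzv_le up.
have m0 : (0 <= mzv_rep R s n)%E.
  by apply: le_trans (elsym_le_mzv R s n 0); rewrite lee_fin elsym0.
have mf : mzv_rep R s n \is a fin_num.
  by rewrite ge0_fin_numE // (le_lt_trans mL) // ltry.
apply/eqP; rewrite eq_le mL /= -(fineK mf) lee_fin -ler_pdivlMl //.
(* Conversely, each finite sum is at most [pi^(-sn)] times a partial sum of the zeta value, and so
   is the limit [l]. *)
apply: (cvgr_to_le xl); near=> M.
apply: le_trans (le_elsym _ (xb M)) _; rewrite elsymZ exprVn -exprM ler_pM2l ?invr_gt0 //.
by rewrite -lee_fin fineK // elsym_le_mzv.
Unshelve. all: by end_near. Qed.

Local Close Scope classical_set_scope.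

(** * The root of unity and the final formula *)

Lemma cexp_2pi_prim_root (R : realType) (m : nat) : (0 < m)%N ->
  m.-primitive_root (cexp (2 * (pi : R)%:C * 'i%C / m%:R)).
Proof.
move=> m0; have mR : m%:R != 0 :> R by rewrite pnatr_eq0 -lt0n.
pose x : R := 2 * pi / m%:R.
have -> : 2 * (pi : R)%:C * 'i%C / m%:R = 0 +i* x.
  have -> : 2 * (pi : R)%:C * 'i%C / m%:R = x%:C * 'i%C :> R[i].
    by rewrite /x !rmorphM fmorphV !rmorph_nat /=; ring.
  by apply/eqP; rewrite eq_complex /= !(mul0r, mulr0, mulr1, oppr0, add0r, addr0) !eqxx.
rewrite /cexp /= expR0 mul1r; set w := _ +i* _.
have wE d : w ^+ d = cos (x *+ d) +i* sin (x *+ d) by exact: cos_addi_sin_exp.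
apply/andP; split => //; apply/forallP => i; apply/eqP; rewrite unity_rootE wE.
have [im|im] := eqVneq i.+1 m.
  apply/eqP; rewrite im -mulr_natr /x divfK // [2 * _]mulrC mulr_natr cos2pi sin2pi.
  by [].
apply/negP => /eqP [] ce _.
(* If a power with exponent [d < m] were 1, then [cos (2 y) = 1] and [sin y = 0] for [y = pi d / m],
   although [sin] is positive on [(0, pi)]. *)
pose y : R := pi * i.+1%:R / m%:R.
have xy : x *+ i.+1 = y *+ 2 by rewrite -mulr_natr -[RHS]mulr_natr /x /y; ring.
have sy : sin y ^+ 2 = 0.
  by move: ce; rewrite xy cos_mulr2n => ce; have := cos2Dsin2 y; lra.
have : 0 < sin y.
  apply: sin_gt0_pi; have p0 := pi_gt0 R.
  rewrite /y divr_gt0 ?mulr_gt0 ?ltr0n //= -mulrA gtr_pMr //.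
  by rewrite ltr_pdivrMr ?ltr0n // mul1r ltr_nat ltn_neqAle im ltn_ord.
by move/eqP: sy; rewrite expf_eq0 /= => /eqP ->; rewrite ltxx.
Qed.

Lemma sum_prim_root (F : fieldType) (m : nat) (w : F) :
  (1 < m)%N -> m.-primitive_root w -> \sum_(j < m) w ^+ j = 0.
Proof.
move=> m1 wp; have := subrX1 w m; rewrite (prim_expr_order wp) subrr.
move/esym/eqP; rewrite mulf_eq0 subr_eq0 => /orP[/eqP w1|/eqP //].
have := prim_order_dvd wp 1; rewrite expr1 w1 eqxx dvdn1 => /eqP m1'.
by rewrite m1' in m1.
Qed.

Theorem theorem1 (R : realType) (m n : nat)
    (m_ge3 : (3 <= m)%N) (m_odd : odd m) (n_gt0 : (0 < n)%N) :
  let w : R[i] := cexp (2 * (pi : R)%:C * 'i%C / m%:R) in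
  mzv_rep R (2 * m) n \is a fin_num /\
  (fine (mzv_rep R (2 * m) n))%:C =
    2 * (2 * (pi : R)%:C) ^+ (2 * m * n) / ((2 * m * n + m)`!)%:R *
    \sum_(1 <= r < (m.-1./2).+1)
       (-1) ^+ r.-1 *
       \sum_(j : r.-tuple 'I_m | sorted ltn (map val j))
          (\sum_(i < r) w ^+ tnth j i) ^+ (2 * m * n + m).
Proof.
move=> w; have wp : m.-primitive_root w by apply: cexp_2pi_prim_root; lia.
pose L := (2 * m * n + m)%N.
pose inner := \sum_(1 <= r < (m.-1./2).+1) (-1) ^+ r.-1 *
  \sum_(A : {set 'I_m} | #|A| == r) (\sum_(j in A) w ^+ j) ^+ L.
have -> : \sum_(1 <= r < (m.-1./2).+1) (-1) ^+ r.-1 *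
    \sum_(j : r.-tuple 'I_m | sorted ltn (map val j))
      (\sum_(i < r) w ^+ tnth j i) ^+ L = inner.
  apply: eq_bigr => r _; congr (_ * _).
  rewrite -sum_sorted_tuple; apply: eq_bigr => t /sorted_map_val_uniq ut.
  by rewrite (big_tnth_set _ (fun j : 'I_m => w ^+ j) ut).
have Lodd : odd L by rewrite /L -mulnA oddD oddM.
pose Z := 2 ^+ L * (2 * inner) / L`!%:R.
pose x M k : R := (M.*2.+1%:R * tan_node R M k) ^- (2 * m).
(* The coefficient of [X^L] is computed twice: by the tangent factorization for each [M], and by the
   subset expansion in the limit. *)
have : complex_cvg (fun M => 2 ^+ m * (elsym (x M) M n)%:C) Z.
  have := coef_prod_pow_diff_cvg L (fun j : 'I_m => w ^+ j).
  under eq_fun => M do rewrite (coef_prod_pow_diff _ _ m_odd wp) -(elsymE (x M)).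
  have -> // : \sum_(A : {set 'I_m}) (-1) ^+ #|~: A| *
     ((\sum_j (if j \in A then w ^+ j else - w ^+ j)) ^+ L / L`!%:R) = Z.
  rewrite /Z -(signed_subset_sum (x := fun j : 'I_m => w ^+ j)) //; last first.
    by apply: sum_prim_root => //; lia.
  by rewrite mulr_suml; apply: eq_bigr => A _; rewrite mulrA.
under eq_fun do rewrite -(rmorph_nat (real_complex R) 2) -rmorphXn -rmorphM /=.
move=> [/= Zr Zi].
(* A limit of real numbers is real, so the sum over roots of unity has no imaginary part. *)
have Z0 : complex.Im Z = 0 by apply: (cvg_unique _ Zi) => //; exact: cvg_cst.
have two0 : 2 ^+ m != 0 :> R by rewrite expf_neq0 // pnatr_eq0.
pose l := complex.Re Z / 2 ^+ m.
have xl : (elsym (x M) M n @[M --> \oo] --> l)%classic.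
  have -> : (fun M => elsym (x M) M n) = (fun M => 2 ^+ m * elsym (x M) M n / 2 ^+ m).
    by apply/funext => M; rewrite [2 ^+ m * _]mulrC mulfK.
  by apply: cvgM => //; exact: cvg_cst.
rewrite (mzv_of_cvg xl); split=> //=.
have ZE : (complex.Re Z)%:C = Z by rewrite [RHS]complexE Z0 rmorph0 mulr0 addr0.
rewrite /l !rmorphM fmorphV !rmorphXn rmorph_nat /= ZE /Z /L.
have t0 : 2 ^+ m != 0 :> R[i] by rewrite expf_neq0 // pnatr_eq0.
(* Of [2^L = 2^(2mn) 2^m], the second factor cancels and the first joins [pi^(2mn)]. *)
by rewrite [2 ^+ (_ + m)]exprD exprMn -/L; field; rewrite t0 pnatr_eq0 -lt0n fact_gt0.
Qed.
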